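(* There is a continuous function $f:2^{\omega}\to 2^{\omega}$ such that $f^{-1}[\{x\}]\notin I_0$ for every $x\in 2^{\omega}$. Consequently the $\sigma$-ideal $I_0$ has property (M) and does not have property (D).
   Context: $2^\omega$ is the Cantor group with coordinatewise addition modulo 2, written $\oplus$ or $+$. $I_0$ is the $\sigma$-ideal on $2^\omega$ generated by the family of all Borel sets $B\subseteq 2^\omega$ for which there is a nonempty perfect set $P\subseteq 2^\omega$ such that the sets $B\oplus x$ ($x\in P$) are pairwise disjoint; $I_0$ is translation invariant and proper. Property (M) for an ideal $I$ on a Polish space $X$: there is a Borel function $f:X\to X$ with $f^{-1}[\{x\}]\notin I$ for every $x\in X$. Property (D) for a translation-invariant ideal $I$ on a Polish abelian group $X$: there are a Borel set $B\notin I$ and a nonempty perfect set $P\subseteq X$ such that $(B+x)\cap(B+y)=\emptyset$ for all distinct $x,y\in P$. *)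

(* Defs.v *)
From HB Require Import structures.
From mathcomp Require Import all_boot all_order all_algebra.
From mathcomp Require Import all_classical all_reals all_analysis.
Set Implicit Arguments. Unset Strict Implicit. Unset Printing Implicit Defensive.
Local Open Scope classical_set_scope.

Definition cxor (x y : cantor_space) : cantor_space := fun n => addb (x n) (y n).

Definition ctrans (B : set cantor_space) (x : cantor_space) : set cantor_space :=
  (fun b => cxor b x) @` B.

Definition cborel (A : set cantor_space) : Prop := <<s [set U | open U] >> A.

Definition cborel_fun (f : cantor_space -> cantor_space) : Prop :=
  forall A, cborel A -> cborel (f @^-1` A).

Definition I0_gen (B : set cantor_space) : Prop :=
  cborel B /\
  exists P : set cantor_space, P !=set0 /\ perfect_set P /\
    (forall x y, P x -> P y -> x <> y -> ctrans B x `&` ctrans B y = set0).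

(* I_0 = the sigma-ideal generated by I0_gen: subsets of countable unions of generators *)
Definition I0 (A : set cantor_space) : Prop :=
  exists B : nat -> set cantor_space,
    (forall n, I0_gen (B n)) /\ A `<=` \bigcup_n B n.

Definition propM (I : set cantor_space -> Prop) : Prop :=
  exists f : cantor_space -> cantor_space,
    cborel_fun f /\ forall x, ~ I (f @^-1` [set x]).

Definition propD (I : set cantor_space -> Prop) : Prop :=
  exists B : set cantor_space, cborel B /\ ~ I B /\
  exists P : set cantor_space, P !=set0 /\ perfect_set P /\
    (forall x y, P x -> P y -> x <> y -> ctrans B x `&` ctrans B y = set0).

(* Main.v *)
(** If [B] has pairwise disjoint translates along a perfect set [P], then [B] is
    disjoint from [B + d] for every [d = p + q] with [p <> q] in [P], and such
    [d] can be chosen to vanish on any prescribed finite set of coordinates.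
    Given a cover of a fiber of [f] by such sets [B_n], pick [d_k] of this kind,
    tending to 0 quickly, each [n] being served by infinitely many [k].
    The function [f] is such that, whatever these [d_k] are, each fiber contains
    all the sums [x + sum_k e_k d_k], [e] in [2^omega], for some [x].  The
    pull-backs [C_n] of the [B_n] under [e |-> x + sum_k e_k d_k] are Borel sets
    covering [2^omega], and [C_n] is disjoint from its image under flipping the
    [k]-th bit, for infinitely many [k].  But a nonmeager [C_n] is comeager in
    some cylinder, which is invariant under flipping any far enough bit. *)

Require Import Defs.
From HB Require Import structures.
From mathcomp Require Import all_boot all_order all_algebra.
From mathcomp Require Import all_classical all_reals all_analysis.
Set Implicit Arguments. Unset Strict Implicit. Unset Printing Implicit Defensive.
Local Open Scope classical_set_scope.

(** * Cylinders as a base of the topology; Borel sets *)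

Definition cyl (x : cantor_space) (n : nat) : set cantor_space :=
  [set y | forall i, (i < n)%N -> y i = x i].

Lemma cyl_subset x y m n : (n <= m)%N -> cyl x n y -> cyl y m `<=` cyl x n.
Proof.
by move=> nm xy z yz i ilt; rewrite yz ?xy//; exact: leq_trans ilt nm.
Qed.

Lemma nbhs_cylP (x : cantor_space) (U : set cantor_space) :
  nbhs x U <-> exists n, cyl x n `<=` U.
Proof.
split.
- pose F := filter_from [set: nat] (cyl x).
  have FF : Filter F.
    apply: filter_from_filter; first by exists 0.
    move=> m n _ _; exists (maxn m n) => // y xy; split=> i ilt; apply: xy;
    by rewrite leq_max ilt ?orbT.
  have : F --> x.
    apply/cvg_sup => i V.
    have /= -> := @nbhsE (initial_topology (fun f : nat -> bool => f i)) x.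
    case=> W [] [] O oO <- Ox WV; exists i.+1 => // y xy.
    apply: WV; move: Ox => /=.
    by rewrite xy.
  by move=> Fx /Fx[n _ nU]; exists n.
- case=> n nU; apply: (filterS nU).
  elim: n {nU} => [|n IHn]; first exact: filterS filterT.
  have pn : nbhs x [set y : cantor_space | y n = x n].
    have := @proj_continuous nat (fun=> bool) n x [set x n].
    by apply; exact: discrete_set1.
  apply: filterS (filterI IHn pn) => y [yx yn] i.
  by rewrite ltnS leq_eqVlt => /predU1P[->|/yx].
Qed.

Lemma open_cylP (U : set cantor_space) :
  open U <-> forall x, U x -> exists n, cyl x n `<=` U.
Proof.
rewrite openE; split=> oU x Ux; first by apply/nbhs_cylP; exact: oU.
by apply/nbhs_cylP; exact: oU.
Qed.

Lemma continuous_finitely_determined (f : cantor_space -> cantor_space) :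
  (forall i, exists N, forall x y, cyl x N y -> f y i = f x i) -> continuous f.
Proof.
move=> fN x U /nbhs_cylP[n nU].
suff [N NP] : exists N, forall y, cyl x N y -> cyl (f x) n (f y).
  by apply/nbhs_cylP; exists N => y /NP /nU.
elim: n {nU} => [|n [N NP]]; first by exists 0.
have [N' N'P] := fN n.
exists (maxn N N') => y xy i; rewrite ltnS leq_eqVlt => /predU1P[->|].
  by apply: N'P => j jN; apply: xy; rewrite leq_max jN orbT.
by apply: NP => j jN; apply: xy; rewrite leq_max jN.
Qed.

Lemma cborel_sub (Q : set (set cantor_space)) :
  sigma_algebra setT Q -> (forall U, open U -> Q U) -> cborel `<=` Q.
Proof. by move=> sQ oQ; exact: smallest_sub. Qed.

Lemma sigma_algebra_cborel : sigma_algebra setT cborel.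
Proof. exact: smallest_sigma_algebra. Qed.

Lemma continuous_cborel_fun (f : cantor_space -> cantor_space) :
  continuous f -> cborel_fun f.
Proof.
move=> cf; apply: (@cborel_sub [set A | cborel (f @^-1` A)]).
- have [b0 bC bU] := sigma_algebra_cborel; split => /=.
  + by rewrite preimage_set0.
  + by move=> A /bC; congr cborel.
  + by move=> A /bU; rewrite preimage_bigcup.
- move=> U oU /=; apply: sub_sigma_algebra.
  by move/continuousP: cf; exact.
Qed.

(** * Baire category *)

(** As [n <= m], the cylinder [cyl y m] lies inside [cyl x n]: this is nowhere density tested on
    basic open sets. *)
Definition nwdense (N : set cantor_space) : Prop :=
  forall x n, exists y m, [/\ (n <= m)%N, cyl x n y & cyl y m `<=` ~` N].

Definition meager (M : set cantor_space) : Prop :=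
  exists N : nat -> set cantor_space,
    (forall j, nwdense (N j)) /\ M `<=` \bigcup_j N j.

Lemma nwdense0 : nwdense set0.
Proof. by move=> x n; exists x, n; split => // y _ []. Qed.

Lemma meager_nwdense N : nwdense N -> meager N.
Proof. by move=> nN; exists (fun=> N); split => // x Nx; exists 0. Qed.

Lemma meager_bigcup (M : nat -> set cantor_space) :
  (forall n, meager (M n)) -> meager (\bigcup_n M n).
Proof.
move=> /choice[N NP].
exists (fun k => if unpickle k is Some (n, j) then N n j else set0); split.
  move=> k; case: unpickle => [[n j]|]; last exact: nwdense0.
  by have [+ _] := NP n; exact.
move=> x [n _ Mx]; have [_ /(_ x Mx)[j _ Nx]] := NP n.
by exists (pickle (n, j)); rewrite ?pickleK.
Qed.

Lemma meagerU M M' : meager M -> meager M' -> meager (M `|` M').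
Proof.
move=> mM mM'; have := @meager_bigcup (fun n => if n is 0 then M else M').
case; first by case.
move=> N [nN MN]; exists N; split => // x [Mx|Mx]; apply: MN.
  by exists 0.
by exists 1.
Qed.

Lemma baire M : meager M -> forall x n, exists y, cyl x n y /\ ~ M y.
Proof.
move=> [N [nN MN]] x n.
have /choice[step stepP] : forall p : nat * (cantor_space * nat),
    exists q : cantor_space * nat,
    [/\ (p.2.2 < q.2)%N, cyl p.2.1 p.2.2 q.1 & cyl q.1 q.2 `<=` ~` N p.1].
  move=> [j [y m]]; have [z [k [mk yz zN]]] := nN j y m.
  (* The successor makes the lengths of the nested cylinders strictly increase. *)
  exists (z, k.+1); split => //= w zw; apply: zN => i ik; apply: zw.
  exact: ltnW.
pose s := fix s j := if j is j'.+1 then step (j', s j') else (x, n).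
have sj j : (j <= (s j).2)%N.
  elim: j => // j IHj; have [/= lt _ _] := stepP (j, s j).
  exact: leq_ltn_trans IHj lt.
have coh j k : cyl (s j).1 (s j).2 (s (j + k)%N).1 /\
               ((s j).2 <= (s (j + k)%N).2)%N.
  elim: k => [|k [IHk lek]]; first by rewrite addn0.
  rewrite addnS; have [/= lt st _] := stepP ((j + k)%N, s (j + k)%N).
  by split; [exact: cyl_subset IHk _ st | exact: leq_trans lek (ltnW lt)].
(* Stage [i.+1] fixes at least [i.+1] coordinates, so bit [i] is final there. *)
pose y : cantor_space := fun i => (s i.+1).1 i.
have ys j : cyl (s j).1 (s j).2 y.
  move=> i ij; rewrite /y; have [ji|ltij] := leqP j i.+1.
    by have [+ _] := coh j (i.+1 - j)%N; rewrite subnKC//; exact.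
  have [+ _] := coh i.+1 (j - i.+1)%N.
  by rewrite subnKC ?(ltnW ltij)// => <- //; exact: sj.
exists y; split; first exact: (ys 0).
move=> /MN[j _]; have [_ _] := stepP (j, s j); apply.
exact: (ys j.+1).
Qed.

Definition baire_property (A : set cantor_space) : Prop :=
  exists U M, [/\ open U, meager M & forall x, ~ M x -> (A x <-> U x)].

Lemma sigma_algebra_baire_property : sigma_algebra setT baire_property.
Proof.
have meager0 : meager set0 by exact/meager_nwdense/nwdense0.
split.
- by exists set0, set0; split => //; exact: open0.
- move=> A [U [M [oU mM AU]]].
  (* [V] is the interior of the complement of [U]; what remains outside both is the boundary of [U],
     which is nowhere dense. *)
  pose V := [set x | exists n, cyl x n `<=` ~` U].
  have oV : open V.
    apply/open_cylP => x [n xn]; exists n => y xy; exists n.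
    by apply: subset_trans xn; exact: cyl_subset.
  have nB : nwdense (~` (U `|` V)).
    move=> x n; have [[y [xy Uy]]|noU] := pselect (cyl x n `&` U !=set0).
      have [m ym] := (open_cylP U).1 oU y Uy.
      exists y, (maxn n m); split; rewrite ?leq_maxl// => z yz; apply; left.
      by apply: ym; apply: cyl_subset yz; rewrite ?leq_maxr.
    exists x, n; split => // z xz; apply; right; exists n => w zw Uw.
    by apply: noU; exists w; split => //; exact: cyl_subset zw.
  exists V, (M `|` ~` (U `|` V)); split => //.
    by apply: meagerU => //; exact: meager_nwdense.
  move=> x /not_orP[Mx /contrapT UV]; split.
    by move=> [_ Ax]; case: UV => // /(AU x Mx).2.
  by move=> [n xn]; split => // /(AU x Mx).1; exact: xn.
- move=> A /choice[U /choice[M UM]].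
  exists (\bigcup_n U n), (\bigcup_n M n); split.
  + by apply: bigcup_open => n _; have [] := UM n.
  + by apply: meager_bigcup => n; have [] := UM n.
  + move=> x Mx; split=> -[n _ Ax]; exists n => //; have [_ _ AU] := UM n.
      by apply/AU => // Mnx; apply: Mx; exists n.
    by apply/AU => // Mnx; apply: Mx; exists n.
Qed.

Lemma cborel_baire_property : cborel `<=` baire_property.
Proof.
apply: cborel_sub; first exact: sigma_algebra_baire_property.
move=> U oU; exists U, set0; split => //.
exact/meager_nwdense/nwdense0.
Qed.

Definition flip (k : nat) (x : cantor_space) : cantor_space :=
  fun i => (i == k) (+) x i.

Lemma flipK k : involutive (flip k).
Proof. by move=> x; apply/funext => i; rewrite /flip addbA addbb. Qed.

Lemma cyl_flip k x n y : cyl x n y -> cyl (flip k x) n (flip k y).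
Proof. by move=> xy i /xy; rewrite /flip => ->. Qed.

Lemma cyl_flip_ge k x n y : (n <= k)%N -> cyl x n y -> cyl x n (flip k y).
Proof.
move=> nk xy i ilt; rewrite /flip xy // ltn_eqF //; exact: leq_trans ilt nk.
Qed.

Lemma meager_flip k M : meager M -> meager (flip k @^-1` M).
Proof.
move=> [N [nN MN]]; exists (fun j => flip k @^-1` N j); split.
  move=> j x n; have [y [m [nm xy yN]]] := nN j (flip k x) n.
  exists (flip k y), m; split => //.
    by rewrite -[x](flipK k); exact: cyl_flip.
  by move=> z /(cyl_flip k); rewrite flipK => /yN.
by move=> x /MN[j _ Nx]; exists j.
Qed.

Lemma cborel_cover_flip (C : nat -> set cantor_space) :
  (forall n, cborel (C n)) -> (forall x, exists n, C n x) ->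
  exists n N, forall k, (N <= k)%N -> exists x, C n x /\ C n (flip k x).
Proof.
move=> bC cover.
have /choice[U /choice[M UM]] n := cborel_baire_property (bC n).
have mM : meager (\bigcup_n M n) by apply: meager_bigcup => n; case: (UM n).
have [x [_ Mx]] := baire mM point 0.
have [n Cx] := cover x; have [oU mMn CU] := UM n.
have {Cx Mx} : U n x by apply/CU => // Mnx; apply: Mx; exists n.
move=> /((open_cylP _).1 oU)[N xN]; exists n, N => k Nk.
(* The flip preserves meagerness, so some point of the cylinder avoids the error set [M n] together
   with its flip. *)
have [y [xy /not_orP[My Mfy]]] := baire (meagerU mMn (meager_flip k mMn)) x N.
exists y; split; first by apply/CU => //; exact: xN.
by apply/CU => //; apply: xN; exact: cyl_flip_ge.
Qed.

(** * The zero-block function *)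

(** Since [pickle] is injective, distinct blocks occupy disjoint coordinates and can be prescribed
    independently. *)
Definition pos (i : nat) (t : seq bool) (l : nat) : nat := pickle (i, t, l).

(* The [i]-th output bit reads [2 ^ i] blocks of [i.+1] bits, one block for
   each word [t] of length [i], and tells whether one of them vanishes. *)
Definition zero_block (z : cantor_space) : cantor_space :=
  fun i => [exists t : i.-tuple bool, [forall l : 'I_i.+1, ~~ z (pos i t l)]].

(** If [d k] vanishes below this bound, adding it leaves the output bits of [zero_block] up to [k]
    unchanged. *)
Definition pos_bound (k : nat) : nat :=
  (k + \max_(i < k.+1) \max_(t : i.-tuple bool) \max_(l < i.+1) pos i t l).+1.

Lemma pos_lt_bound k i (t : i.-tuple bool) (l : 'I_i.+1) :
  (i <= k)%N -> (pos i t l < pos_bound k)%N.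
Proof.
move=> ik; rewrite ltnS; apply: leq_trans (leq_addl _ _).
have ik1 : (i < k.+1)%N by [].
apply: (bigmax_sup (Ordinal ik1)) => //=; apply: (bigmax_sup t) => //.
exact: (bigmax_sup l).
Qed.

Lemma continuous_zero_block : continuous zero_block.
Proof.
apply: continuous_finitely_determined => i; exists (pos_bound i) => x y xy.
apply: eq_existsb => t; apply: eq_forallb => l.
by rewrite xy // pos_lt_bound.
Qed.

(** * Translating by sums of a sequence tending to zero *)

Section span.
Variable d : nat -> cantor_space.

Definition comb (m : nat) (e : nat -> bool) (n : nat) : bool :=
  \big[addb/false]_(k < m) (e k && d k n).

Lemma comb_widen m m' e n : (m <= m')%N ->
  (forall k, (m <= k)%N -> d k n = false) -> comb m' e n = comb m e n.
Proof.
move=> /subnKC <- dk; elim: (m' - m)%N => [|j IHj]; first by rewrite addn0.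
rewrite addnS /comb big_ord_recr /= -/(comb _ _ _) IHj dk ?leq_addr//.
by rewrite andbF addbF.
Qed.

Lemma comb_stable m m' e n :
  (forall k, (m <= k)%N -> d k n = false) ->
  (forall k, (m' <= k)%N -> d k n = false) -> comb m e n = comb m' e n.
Proof.
by move=> dm dm'; case: (leqP m m') => [mm'|/ltnW mm']; [symmetry|];
  apply: comb_widen.
Qed.

Lemma comb_flip m k e n :
  comb m (flip k e) n = comb m e n (+) ((k < m)%N && d k n).
Proof.
elim: m => [|m IHm]; first by rewrite /comb !big_ord0.
rewrite /comb !big_ord_recr /= -!/(comb _ _ _) IHm /flip ltnS.
rewrite [(k <= m)%N]leq_eqVlt [m == k]eq_sym.
have [->|_] := eqVneq k m; last by rewrite addbAC.
by rewrite ltnn /= addbF; case: (e m) (d m n) (comb m e n) => -[] [].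
Qed.

Hypothesis d_diag : forall k n, (n <= k)%N -> d k n = false.
Hypothesis d_pos : forall k i (t : i.-tuple bool) (l : 'I_i.+1),
  (i <= k)%N -> d k (pos i t l) = false.

(** Truncation at [k < n] gives the full infinite sum at coordinate [n], since later [d k] vanish
    there by [d_diag]. *)
Definition shift (x e : cantor_space) : cantor_space :=
  fun n => x n (+) comb n e n.

Lemma continuous_shift x : continuous (shift x).
Proof.
apply: continuous_finitely_determined => n; exists n => e e' ee'.
congr (_ (+) _); apply: eq_bigr => k _; congr (_ && _); exact: ee'.
Qed.

Lemma shift_flip x k e : shift x (flip k e) = cxor (shift x e) (d k).
Proof.
apply/funext => n; rewrite /shift /cxor comb_flip addbA.
by case: ltnP => // /d_diag ->.
Qed.

(** A block of level [i] sees only the [i] vectors [d k] with [k < i], one fewer than its length. *)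
Lemma shift_pos x e i (t : i.-tuple bool) (l : 'I_i.+1) :
  shift x e (pos i t l) = x (pos i t l) (+) comb i e (pos i t l).
Proof.
congr (_ (+) _); apply: comb_stable => k; first exact: d_diag.
exact: d_pos.
Qed.

(** Counting: at most [2 ^ i] combinations cannot exhaust the [2 ^ i.+1] values of a block. *)
Lemma outside_span i (t : seq bool) :
  exists y : nat -> bool, forall e, exists l : 'I_i.+1,
    y l (+) comb i e (pos i t l).
Proof.
pose h (a : {ffun 'I_i -> bool}) : {ffun 'I_i.+1 -> bool} :=
  [ffun l : 'I_i.+1 => \big[addb/false]_(k < i) (a k && d k (pos i t l))].
have : ~~ [forall v, v \in codom h].
  apply/negP => /forallP hsurj.
  have : (#|{ffun 'I_i.+1 -> bool}| <= #|{ffun 'I_i -> bool}|)%N.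
    apply: leq_trans (leq_image_card h predT).
    by apply: subset_leq_card; apply/fintype.subsetP => v _; exact: hsurj.
  by rewrite !card_ffun card_bool !card_ord leq_exp2l // ltnn.
move=> /forallPn[v vh]; exists (fun n => v (inord n)) => e.
apply: contrapT => noL; move/negP: vh; apply.
have -> : v = h [ffun k : 'I_i => e k]; last exact: codom_f.
apply/ffunP => l; rewrite ffunE; under eq_bigr do rewrite ffunE.
apply/eqP; apply: contrapT => /negP vl; apply: noL; exists l.
by rewrite inord_val -/(comb _ _ _) -negb_eqb.
Qed.

(* On block [t] of level [i] put the combination with coefficients [t] if [b i]
   (it cancels when [e] extends [t]), and a vector outside the span of the
   [d k], [k < i], otherwise (then no block ever vanishes). *)
Lemma shift_in_fiber (b : cantor_space) :
  exists x, forall e, zero_block (shift x e) = b.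
Proof.
have /choice[y yP] (p : nat * seq bool) := outside_span p.1 p.2.
pose x : cantor_space := fun n =>
  if unpickle n is Some (i, t, l) then
    if b i then comb i (nth false t) n else y (i, t) l
  else false.
have xE i t l : x (pos i t l) =
    if b i then comb i (nth false t) (pos i t l) else y (i, t) l.
  by rewrite /x /pos pickleK.
exists x => e; apply/funext => i; rewrite /zero_block.
case bi: (b i).
  apply/existsP; exists [tuple e k | k < i]; apply/forallP => l.
  rewrite shift_pos xE bi.
  suff -> : forall n, comb i (nth false [tuple e k | k < i]) n = comb i e n.
    by rewrite addbb.
  by move=> n; apply: eq_bigr => k _; rewrite -tnth_nth tnth_mktuple.
apply/negbTE/existsPn => t; apply/forallPn.
have [l /= yl] := yP (i, val t) e.
by exists l; rewrite negbK shift_pos xE bi.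
Qed.

End span.

(** * Fibers of [zero_block] are not in [I0] *)

Lemma perfect_set_close (P : set cantor_space) N : P !=set0 -> perfect_set P ->
  exists p q, [/\ P p, P q, p <> q & cyl p N q].
Proof.
move=> [p Pp] [_ lP]; have : limit_point P p by rewrite lP.
have /[swap]/[apply] : nbhs p (cyl p N) by apply/nbhs_cylP; exists N.
by move=> [q [/eqP qp Pq pq]]; exists p, q; split => // /esym.
Qed.

Lemma zero_block_fiber_notin_I0 (b : cantor_space) :
  ~ I0 (zero_block @^-1` [set b]).
Proof.
move=> [B [gB cover]].
have /choice[P PP] n : exists P : set cantor_space, P !=set0 /\ perfect_set P /\
    (forall x y, P x -> P y -> x <> y ->
      ctrans (B n) x `&` ctrans (B n) y = set0) by case: (gB n).
(* every [n] equals [logn 2 k.+1] for infinitely many [k] *)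
pose nu k := logn 2 k.+1.
(* Agreement below [pos_bound k] yields both [d_diag] and [d_pos] for the differences. *)
have /choice[p /choice[q pq]] k : exists p q,
    [/\ P (nu k) p, P (nu k) q, p <> q & cyl p (pos_bound k) q].
  by have [P0 [pP _]] := PP (nu k); exact: perfect_set_close.
pose d k := cxor (p k) (q k).
have d0 k n : (n < pos_bound k)%N -> d k n = false.
  have [_ _ _ pqk] := pq k.
  by move=> /pqk; rewrite /d /cxor => ->; rewrite addbb.
have d_diag k n : (n <= k)%N -> d k n = false.
  by move=> nk; apply: d0; rewrite ltnS; exact: leq_trans nk (leq_addr _ _).
have d_pos k i (t : i.-tuple bool) (l : 'I_i.+1) :
    (i <= k)%N -> d k (pos i t l) = false.
  by move=> ik; apply: d0; exact: pos_lt_bound.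
have [x xb] := shift_in_fiber d_diag d_pos b.
have bC n : cborel (shift d x @^-1` B n).
  by apply: continuous_cborel_fun; [exact: continuous_shift|case: (gB n)].
(* This [k] satisfies [nu k = n] by the factor [2 ^ n], and [N <= k] because [N < 3 ^ N]. *)
have [|n [N /(_ (2 ^ n * 3 ^ N).-1)]] := cborel_cover_flip bC.
  by move=> e; have [|n _ Be] := cover (shift d x e); [exact: xb|exists n].
set k := _.-1; have k1 : k.+1 = (2 ^ n * 3 ^ N)%N.
  by rewrite prednK // muln_gt0 !expn_gt0.
have nuk : nu k = n.
  by rewrite /nu k1 lognM ?expn_gt0// !lognX /= muln1 muln0 addn0.
case.
  rewrite -ltnS k1; apply: (leq_trans (ltn_expl N (isT : 1 < 3)%N)).
  by rewrite leq_pmull // expn_gt0.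
move=> e /= [Be]; rewrite shift_flip // => Bed.
have [Pp Pq pneq _] := pq k; rewrite nuk in Pp Pq.
have [_ [_ /(_ _ _ Pp Pq pneq)]] := PP n.
(* With [s = shift d x e], the common point is [s + p k = (s + d k) + q k]. *)
apply/eqP/set0P; exists (cxor (shift d x e) (p k)); split.
  by exists (shift d x e).
exists (cxor (shift d x e) (d k)) => //; apply/funext => m.
by rewrite /d /cxor -!addbA addbb addbF.
Qed.

Theorem theorem2p1 :
  (exists f : cantor_space -> cantor_space,
      continuous f /\ forall x : cantor_space, ~ I0 (f @^-1` [set x]))
  /\ propM I0 /\ ~ propD I0.
Proof.
split; [|split].
- exists zero_block; split; first exact: continuous_zero_block.
  exact: zero_block_fiber_notin_I0.
- exists zero_block; split; last exact: zero_block_fiber_notin_I0.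
  by apply: continuous_cborel_fun; exact: continuous_zero_block.
(* A witness of (D) is itself a generator of [I0], hence belongs to [I0]. *)
- move=> [B [bB [nB PB]]]; apply: nB; exists (fun=> B).
  by split => [n|x Bx]; [split|exists 0%N].
Qed.
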